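(* Let $P_4(n)$ be the number of payphone permutations of type (P4) and size $n$. Then $P_4(1) = 1$, $P_4(2) = 2$, $P_4(3) = 4$, and for any integer $n\geq 4$, $$P_4(n) = 2F(S'(n-1)) + 2F(S'(n-2)) + \sum_{i=3}^{n-2} F\big(S'(i-1)\cup S'(n-i)\big).$$
   Context: Multisets: $\#_k M$ denotes the multiplicity of $k$ in the multiset $M$, and $\cup$ denotes union of multisets with multiplicities added. For $n\ge 0$, the finite multiset $S(n)$ of positive integers is defined recursively by $S(0)=\emptyset$ and $$S(n)=\{n\}\cup S\left(\left\lfloor\tfrac{n-1}{2}\right\rfloor\right)\cup S\left(\left\lceil\tfrac{n-1}{2}\right\rceil\right)\quad (n\ge 1).$$ Further, $S'(0):=\emptyset$ and $S'(\ell):=S(\ell-1)\cup\{2\ell-1\}$ for $\ell\ge 1$. The function $F$ is defined on the finite multisets $M$ of positive integers by $$F(M) := \bigg(\prod_{k\geq 1} (\#_k M)!\bigg)\cdot 2^{\sum_{k\geq 1} \#_{2k} M}.$$ An empty sum equals $0$. Type (P4) payphone permutations: $n$ payphones, labeled $1,\dots,n$, are arranged in a row; the distance between payphones $i$ and $j$ is $|i-j|$. Persons $1,2,\dots,n$ come one after another and each occupies an available payphone. The first person takes any payphone. An interval is a maximal sequence of available consecutive payphones; its length is the number of payphones in it. An interval is semi-closed or closed if it is flanked by $1$ or $2$ occupied payphones, respectively. The full length of a closed interval is its length; the full length of a semi-closed interval of length $\ell$ is $2\ell-1$. The payphone forming a closed interval of length $1$ is called sandwiched. Rule (P2) is: a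 person first selects any interval of greatest full length and then takes, within it, any payphone whose distance to its closest occupied payphone is as large as possible. Each person after the first obeys rule (P4): the person follows rule (P2), except that a payphone adjacent to a single occupied payphone is preferred to a sandwiched payphone. That is, the person follows (P2), but when the greatest full length is $1$ (so every interval is a single payphone), the person takes the payphone of any semi-closed interval of length $1$ if there is one, and otherwise takes any (sandwiched) available payphone. The resulting assignment of people to payphones, $(p_1,\dots,p_n)$ with $p_j$ the person occupying payphone $j$, is a payphone permutation of type (P4) and size $n$; $P_4(n)$ counts the distinct permutations of $\{1,\dots,n\}$ that can arise this way. *)

(* Defs.v *)
From mathcomp Require Import all_boot all_order all_fingroup.
From mathcomp Require Import finmap multiset.

Set Implicit Arguments.
Unset Strict Implicit.
Unset Printing Implicit Defensive.

Local Open Scope nat_scope.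
Local Open Scope mset_scope.

(* [S_rec d n] is S(n) as soon as the fuel [d] is at least [n]: both recursive
   arguments are at most n - 1.  For n = m.+1 they are floor(m/2) = m./2 and
   ceil(m/2) = uphalf m. *)
Fixpoint S_rec (d n : nat) : {mset nat} :=
  if d is d'.+1 then
    if n is m.+1 then
      [mset n] `+` S_rec d' m./2 `+` S_rec d' (uphalf m)
    else mset0
  else mset0.

Definition Smset (n : nat) : {mset nat} := S_rec n n.

Lemma S_rec_fuel (d n : nat) : n <= d -> S_rec d n = Smset n.
Proof.
rewrite /Smset; elim/ltn_ind: n d => -[|m] IH [|d] // le_md /=.
have half_le : m./2 <= m by rewrite leq_half_double leqW // -addnn leq_addr.
have uphalf_le : uphalf m <= m by rewrite leq_uphalf_double -addnn leq_addr.
rewrite (IH _ _ d) ?(IH (uphalf m) _ d) ?ltnS //.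
- by rewrite (IH _ _ m) ?(IH (uphalf m) _ m) ?ltnS.
- exact: leq_trans uphalf_le le_md.
- exact: leq_trans half_le le_md.
Qed.

Lemma Smset0 : Smset 0 = mset0.
Proof. by []. Qed.

Lemma SmsetS (m : nat) :
  Smset m.+1 = [mset m.+1] `+` Smset m./2 `+` Smset (uphalf m).
Proof.
rewrite {1}/Smset /= !S_rec_fuel //.
- by rewrite leq_uphalf_double -addnn leq_addr.
- by rewrite leq_half_double leqW // -addnn leq_addr.
Qed.

Definition Smset' (l : nat) : {mset nat} :=
  if l is l'.+1 then Smset l' `+` [mset (2 * l - 1)%N] else mset0.

(* Indices outside the support contribute a factor 0! = 1 and a summand 0, so
   the product and the sum are restricted to the support.  The sum of
   #_{2k} M over k >= 1 is indexed by j = 2k. *)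
Definition F (M : {mset nat}) : nat :=
  (\prod_(k <- finsupp M | 0 < k) (M k)`!) *
  2 ^ (\sum_(j <- finsupp M | (0 < j) && ~~ odd j) M j).

(* The payphones and the persons 1, ..., n are represented by the elements
   0, ..., n - 1 of 'I_n.  [occ] is the set of occupied payphones. *)

Definition pdist n (i j : 'I_n) : nat := maxn i j - minn i j.

Definition consecutive n (I : {set 'I_n}) : bool :=
  [forall i in I, forall k in I, forall j : 'I_n, (i <= j <= k) ==> (j \in I)].

Definition is_interval n (occ I : {set 'I_n}) : bool :=
  maxset (fun J : {set 'I_n} =>
            [&& J != set0, consecutive J & [disjoint J & occ]]) I.

Definition flanks n (occ I : {set 'I_n}) : nat :=
  #|[set x in occ | [exists y in I, pdist x y == 1]]|.

Definition semi_closed n (occ I : {set 'I_n}) : bool :=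
  is_interval occ I && (flanks occ I == 1).

Definition closed_interval n (occ I : {set 'I_n}) : bool :=
  is_interval occ I && (flanks occ I == 2).

(* Only meant for nonempty [occ], when every interval is semi-closed or
   closed. *)
Definition full_length n (occ I : {set 'I_n}) : nat :=
  if closed_interval occ I then #|I| else 2 * #|I| - 1.

Definition max_full_length n (occ : {set 'I_n}) : nat :=
  \max_(I : {set 'I_n} | is_interval occ I) full_length occ I.

(* The default value [n] exceeds every distance, and is the value of the
   minimum only if [occ] is empty. *)
Definition closest_dist n (occ : {set 'I_n}) (x : 'I_n) : nat :=
  \big[minn/n]_(y in occ) pdist x y.

Definition P2_step n (occ : {set 'I_n}) (x : 'I_n) : bool :=
  [exists I : {set 'I_n},
    [&& is_interval occ I, full_length occ I == max_full_length occ, x \in I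
      & [forall y in I, closest_dist occ y <= closest_dist occ x]]].

Definition P4_step n (occ : {set 'I_n}) (x : 'I_n) : bool :=
  if max_full_length occ == 1 then
    if [exists I : {set 'I_n}, semi_closed occ I && (#|I| == 1)] then
      [exists I : {set 'I_n}, [&& semi_closed occ I, #|I| == 1 & x \in I]]
    else x \notin occ
  else P2_step occ x.

(* [p x] is the person occupying payphone [x]; when that person arrives, the
   occupied payphones are those taken by the persons of smaller label.  The
   first person, labeled 0, is unconstrained. *)
Definition P4_perm n (p : 'S_n) : bool :=
  [forall x : 'I_n, (0 < p x) ==> P4_step [set y | p y < p x] x].

Definition P4 (n : nat) : nat := #|[set p : 'S_n | P4_perm p]|.

(* Main.v *)
Require Import Defs.
From mathcomp Require Import all_boot all_order all_fingroup.
From mathcomp Require Import finmap multiset.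
From mathcomp Require Import zify.

(* While occ is the set of occupied payphones, the full lengths that still have
   to be selected form a multiset M: a closed interval of length l contributes
   S(l), a semi-closed one S'(l), because the person who selects an interval
   removes exactly its full length from M.  A selected full length is always the
   maximum L of M, its multiplicity #_L M is the number of intervals attaining
   it, and the payphone within the interval is unique for odd L and one of two
   for even L.  Multiplying these choices gives F(M).  Only the semi-closed
   intervals of length 1 behave differently: (P4) delays them until the greatest
   full length is 1, and then serves them first, so a of them contribute a
   factor a! and are left out of M.  They arise from the first person only, when
   the second or the last but one payphone is taken. *)

Local Open Scope nat_scope.
Local Open Scope mset_scope.

(** * Permutations counted move by move *)

Fixpoint completions (T : finType) (st : {set T} -> pred T) (k : nat)
    (occ : {set T}) : nat :=
  if k is k'.+1 then
    \sum_(x | (x \notin occ) && st occ x) completions T st k' (x |: occ)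
  else 1.

Lemma card_uniq_ord (n : nat) (s : seq 'I_n) (x : 'I_n) :
  uniq s -> size s = n -> x \in s.
Proof.
move=> us sz.
have [||_ ->] := @uniq_min_size _ s (enum 'I_n) us.
- by move=> y _; rewrite mem_enum.
- by rewrite -cardE card_ord sz.
- by rewrite mem_enum.
Qed.

Lemma perm_agree_mem (n : nat) (p : 'S_n) (s : seq 'I_n) (x : 'I_n) :
  [seq val (p y) | y <- s] = iota 0 (size s) -> (x \in s) = (p x < size s).
Proof.
move=> E; have -> : (p x < size s) = (val (p x) \in [seq val (p y) | y <- s]).
  by rewrite E mem_iota.
by rewrite (mem_map (f := fun y => val (p y))) // => y z /val_inj /perm_inj.
Qed.

(** Here [s] lists the payphones of the first [size s] persons in order of arrival. For the
    induction on [k], the permutations are sorted by the payphone of the next person, which is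
    appended to [s]. When nobody is left, [s] enumerates all payphones and the only permutation is
    the index in [s]. *)
Lemma perm_completions (n : nat) (st : {set 'I_n} -> pred 'I_n)
    (k : nat) (s : seq 'I_n) :
  uniq s -> size s + k = n ->
  #|[set p : 'S_n | ([seq val (p y) | y <- s] == iota 0 (size s))
     && [forall x, (size s <= p x) ==> st [set y | p y < p x] x]]|
  = completions _ st k [set x in s].
Proof.
elim: k s => [|k IH] s us sz.
  rewrite addn0 in sz.
  have lt_ind (x : 'I_n) : index x s < n.
    by rewrite -{2}sz index_mem card_uniq_ord.
  pose f x := Ordinal (lt_ind x).
  have finj : injective f.
    move=> x y /(congr1 val) /= /(congr1 (nth x s)).
    by rewrite !nth_index ?card_uniq_ord.
  rewrite /=; apply: (@eq_card1 _ (perm finj)) => p; rewrite !inE.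
  apply/andP/eqP => [[/eqP E _]|->].
    apply/permP => x; apply/val_inj; rewrite permE /=.
    have xs : x \in s by rewrite card_uniq_ord.
    have := congr1 (nth 0 ^~ (index x s)) E.
    by rewrite (nth_map x) ?index_mem // nth_index // nth_iota ?index_mem.
  split; last by apply/forallP => x; rewrite leqNgt sz ltn_ord.
  apply/eqP; apply: (@eq_from_nth _ 0); rewrite ?size_map ?size_iota // => i lti.
  have x0 : 'I_n by exists i; rewrite -sz.
  by rewrite (nth_map x0) // permE /= index_uniq // nth_iota.
have ltsn : size s < n by apply: leq_trans (leq_addr k _) _; rewrite addSnnS sz.
rewrite -sum1_card (partition_big (fun p : 'S_n => (p^-1)%g (Ordinal ltsn))
  predT) //= [RHS]big_mkcond /=.
apply: eq_bigr => x _.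
have key (p : 'S_n) : ((p^-1)%g (Ordinal ltsn) == x) = (p x == size s :> nat).
  rewrite -(inj_eq (@perm_inj _ p)) permKV eq_sym.
  by rewrite -(inj_eq val_inj).
rewrite sum1_card.
case: ifP => [/andP[xs stx]|H].
  have -> : x |: [set y in s] = [set y in rcons s x].
    by apply/setP => y; rewrite !inE mem_rcons inE.
  rewrite inE in xs.
  rewrite -IH ?rcons_uniq ?xs // ?size_rcons ?addSnnS //.
  apply: eq_card => p; rewrite !inE unfold_in /= inE key.
  have iotaS : 0 :: iota 1 (size s) = rcons (iota 0 (size s)) (size s).
    by rewrite -/(iota 0 (size s).+1) -addn1 iotaD cats1.
  rewrite map_rcons iotaS eqseq_rcons.
  case E: (_ == _) => //=.
  case Ex: (val (p x) == size s) => /=; last by rewrite andbF.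
  rewrite andbT.
  apply/forallP/forallP => /= H y; apply/implyP => ly.
    by apply: (implyP (H y)); apply: leq_trans ly.
  case: (ltngtP (size s) (p y)) ly => // [ly|ey] _.
    by apply: (implyP (H y)).
  have -> : y = x by apply: (@perm_inj _ p); apply: ord_inj; rewrite -ey -(eqP Ex).
  have -> // : [set z | p z < p x] = [set z in s].
  by apply/setP => z; rewrite !inE (perm_agree_mem _ _ _ _ (eqP E)) (eqP Ex).
(* An [x] that is already in [s], or is not allowed by [st], is the next payphone of no permutation
   counted. *)
apply: eq_card0 => p; rewrite !inE unfold_in /= inE key.
apply/negbTE; apply: contraFN H => /andP[/andP[/eqP E /forallP Hs] /eqP Ex].
have xs : x \notin s by rewrite (perm_agree_mem _ _ _ _ E) Ex ltnn.
rewrite inE xs; have := Hs x; rewrite Ex leqnn /=.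
by have -> // : [set z | p z < size s] = [set z in s];
  apply/setP => z; rewrite !inE (perm_agree_mem _ _ _ _ E).
Qed.

(** The guard [occ != set0] exempts the first person: for every later one, the payphone of person 0
    is already occupied. *)
Lemma P4_completions (n : nat) :
  P4 n = completions 'I_n (fun occ x => (occ != set0) ==> P4_step occ x) n set0.
Proof.
have -> : set0 = [set x in [::] : seq 'I_n].
  by apply/setP => x; rewrite !inE.
rewrite -perm_completions //; apply: eq_card => p; rewrite !inE /=.
apply: eq_forallb => x; congr (_ ==> _).
apply/idP/set0Pn => [px|[y]]; last by rewrite inE; apply: leq_trans.
have n0 : 0 < n by apply: leq_trans (ltn_ord x).
by exists ((p^-1)%g (Ordinal n0)); rewrite inE permKV.
Qed.

(** * The function F over a fixed range *)

(* F with its infinite ranges cut at B. *)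
Definition weight (B : nat) (f : nat -> nat) : nat :=
  (\prod_(1 <= k < B) (f k)`!) * 2 ^ (\sum_(1 <= j < B | ~~ odd j) f j).

Lemma F_weight (B : nat) (M : {mset nat}) :
  (forall k, B <= k -> M k = 0) -> F M = weight B M.
Proof.
move=> MB.
have perm_supp : perm_eq [seq k <- finsupp M | 0 < k]
                         [seq k <- index_iota 1 B | M k != 0].
  apply: uniq_perm; rewrite ?filter_uniq ?fset_uniq ?iota_uniq // => k.
  rewrite !mem_filter msuppE -mset_neq0 mem_index_iota andbC.
  case: (ltnP k B) => kB; first by rewrite andbT.
  by rewrite MB.
rewrite /F /weight; congr (_ * 2 ^ _).
  rewrite -big_filter (perm_big _ perm_supp) big_filter /= big_mkcond /=.
  by apply: eq_bigr => k _; case: (M k).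
rewrite -big_filter_cond (perm_big _ perm_supp) big_filter_cond /=.
rewrite big_mkcond [RHS]big_mkcond /=.
by apply: eq_bigr => k _; case: (M k) => //=; case: ifP.
Qed.

Lemma eq_weight (B : nat) (f g : nat -> nat) : f =1 g -> weight B f = weight B g.
Proof.
by move=> fg; rewrite /weight; congr (_ * 2 ^ _); apply: eq_bigr => k _; rewrite fg.
Qed.

(** One more copy of [L] multiplies the factorial at [L] by the new multiplicity, and the power of 2
    by 2 exactly when [L] is even. The factor is the number of choices of the person who selects
    [L]. *)
Lemma weight_pop (B L : nat) (f g : nat -> nat) :
  0 < L < B -> (forall k, f k = (k == L) + g k) ->
  weight B f = f L * (~~ odd L).+1 * weight B g.
Proof.
move=> /andP[L0 LB] fg; rewrite /weight.
have Lin : L \in index_iota 1 B by rewrite mem_index_iota L0.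
have Lu : uniq (index_iota 1 B) by apply: iota_uniq.
rewrite (bigD1_seq L) // [in RHS](bigD1_seq L) //= fg eqxx add1n factS.
rewrite (eq_bigr (fun k => (g k)`!)) => [|k /negbTE kL]; last by rewrite fg kL.
rewrite -!mulnA; congr (_ * _).
rewrite [RHS]mulnCA; congr (_ * _); rewrite [RHS]mulnCA; congr (_ * _).
rewrite (eq_bigr (fun j => (j == L) + g j)) => [|j _]; last by rewrite fg.
rewrite big_split expnD; congr (_ * _).
rewrite big_mkcond /= (bigD1_seq L) //= eqxx big1 => [|j /negbTE jL].
  by case: (odd L).
by rewrite jL; case: odd.
Qed.

(** * Gaps between occupied payphones *)

(** Positions are plain numbers here, so that [a.-1] and [b] need no range proof; a number outside
    the row is never taken. *)
Definition taken {n : nat} (occ : {set 'I_n}) (k : nat) : bool :=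
  [exists x in occ, val x == k].

Lemma taken_ord {n : nat} (occ : {set 'I_n}) (x : 'I_n) : taken occ x = (x \in occ).
Proof.
apply/exists_inP/idP => [[y yo /eqP/val_inj <-]//|xo].
by exists x.
Qed.

Lemma takenP {n : nat} {occ : {set 'I_n}} {k : nat} :
  taken occ k -> exists2 x : 'I_n, x \in occ & val x = k.
Proof. by move=> /exists_inP[x xo /eqP xk]; exists x. Qed.

Lemma takenU1 {n : nat} (occ : {set 'I_n}) (x : 'I_n) (k : nat) :
  taken (x |: occ) k = (k == x) || taken occ k.
Proof.
apply/idP/orP => [/takenP[y] | [/eqP->|/takenP[y yo <-]]].
- by rewrite !inE => /orP[/eqP->|yo] <-; rewrite ?eqxx ?taken_ord; [left|right].
- by rewrite taken_ord setU11.
- by rewrite taken_ord inE yo orbT.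
Qed.

(* The payphones a, ..., b - 1 are available and nothing more can be added at
   either end; a = b is allowed, so that occupying x always replaces its gap
   (a, b) by the two gaps (a, x) and (x + 1, b). *)
Definition gap {n : nat} (occ : {set 'I_n}) (a b : nat) : bool :=
  [&& a <= b <= n, (a == 0) || taken occ a.-1, (b == n) || taken occ b
    & all (fun k => ~~ taken occ k) (index_iota a b)].

Lemma gapP {n : nat} {occ : {set 'I_n}} {a b : nat} :
  reflect [/\ a <= b <= n, a = 0 \/ taken occ a.-1, b = n \/ taken occ b
            & forall k, a <= k < b -> ~~ taken occ k]
          (gap occ a b).
Proof.
apply: (iffP and4P) => -[-> Ha Hb Hab]; split => //.
- by case/orP: Ha => [/eqP|]; [left|right].
- by case/orP: Hb => [/eqP|]; [left|right].
- by move=> k kab; apply: (allP Hab); rewrite mem_index_iota.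
- by case: Ha => ->; rewrite ?eqxx ?orbT.
- by case: Hb => ->; rewrite ?eqxx ?orbT.
- by apply/allP => k; rewrite mem_index_iota; apply: Hab.
Qed.

(** Take the last possible left end up to [k] and the first possible right end from [k] on. A taken
    [j] between them would itself be an earlier right end if [k <= j], and [j.+1] would be a later
    left end otherwise. *)
Lemma gap_exists {n : nat} (occ : {set 'I_n}) (k : nat) :
  k < n -> ~~ taken occ k -> exists a b, gap occ a b /\ a <= k < b.
Proof.
move=> kn kfree.
pose A a := (a <= k) && ((a == 0) || taken occ a.-1).
pose B b := (k <= b <= n) && ((b == n) || taken occ b).
have exA : exists a, A a by exists 0.
have ubA a : A a -> a <= k by case/andP.
have exB : exists b, B b by exists n; rewrite /B eqxx leqnn (ltnW kn).
case: (ex_maxnP exA ubA) => a /andP[ak Ha] maxa.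
case: (ex_minnP exB) => b /andP[/andP[kb bn] Hb] minb.
have kltb : k < b.
  rewrite ltn_neqAle kb andbT; apply: contraNneq kfree => kE.
  by move: Hb; rewrite -kE ltn_eqF.
exists a, b; split; last by rewrite ak.
apply/and4P; split; rewrite ?bn ?(leq_trans ak kb) //.
apply/allP => j; rewrite mem_index_iota => /andP[aj jb].
apply/negP => tj; have [kj|jk] := leqP k j.
  have := minb j; rewrite /B kj (leq_trans (ltnW jb) bn) tj orbT leqNgt jb.
  by move=> /(_ isT).
by have := maxa j.+1; rewrite /A jk tj /= ltnNge aj => /(_ isT).
Qed.

(** If two ends differed, the taken payphone bounding one gap would lie inside the other. *)
Lemma gap_unique {n : nat} (occ : {set 'I_n}) (a b c d k : nat) :
  gap occ a b -> gap occ c d -> a <= k < b -> c <= k < d -> a = c /\ b = d.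
Proof.
move=> /gapP[abn Ha Hb Hab] /gapP[cdn Hc Hd Hcd] kab kcd.
have bn (H : b < d) : taken occ b by case: Hb => //; lia.
have dn (H : d < b) : taken occ d by case: Hd => //; lia.
have an (H : c < a) : taken occ a.-1 by case: Ha => //; lia.
have cn (H : a < c) : taken occ c.-1 by case: Hc => //; lia.
have clash (u v j : nat) : (forall i, u <= i < v -> ~~ taken occ i) ->
    u <= j < v -> ~ taken occ j by move=> free juv; apply/negP/free.
split.
- case: (ltngtP a c) => // H.
  + by case: (clash _ _ c.-1 Hab _ (cn H)); lia.
  + by case: (clash _ _ a.-1 Hcd _ (an H)); lia.
- case: (ltngtP b d) => // H.
  + by case: (clash _ _ b Hcd _ (bn H)); lia.
  + by case: (clash _ _ d Hab _ (dn H)); lia.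
Qed.

Lemma gap_free {n : nat} (occ : {set 'I_n}) (a b k : nat) :
  gap occ a b -> a <= k < b -> taken occ k = false.
Proof. by move=> /gapP[_ _ _ Hab] /Hab/negbTE. Qed.

(** A new gap that starts just after [x] must end at [b], one that ends at [x] must start at [a],
    and the bounds of any other new gap were there before [x] was taken. *)
Lemma gapU1 {n : nat} (occ : {set 'I_n}) (a b : nat) (x : 'I_n) (c d : nat) :
  gap occ a b -> a <= x < b ->
  gap (x |: occ) c d =
  [|| gap occ c d && ((c, d) != (a, b)), (c, d) == (a, x : nat) | (c, d) == (x.+1, b)].
Proof.
move=> gab xab; have freex := gap_free _ _ _ _ gab xab.
have [abn Ha Hb Hab] := gapP gab.
have ltxn := ltn_ord x.
apply/idP/or3P => [gcd'|].
  have [cdn Hc Hd Hcd] := gapP gcd'.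
  have nx : ~~ (c <= x < d).
    by apply: contraT => /negPn /Hcd; rewrite takenU1 eqxx.
  have free k : c <= k < d -> ~~ taken occ k.
    by move=> /Hcd; rewrite takenU1 negb_or => /andP[].
  have [cx|ncx] := eqVneq c x.+1.
    apply: Or33; rewrite cx; apply/eqP; congr pair.
    case: (ltngtP d b) => // db.
    + case: Hd => [|]; first lia.
      rewrite takenU1 => /orP[/eqP|td]; first lia.
      by move: (Hab d); rewrite td; lia.
    + case: Hb => [|tb]; first lia.
      by move: (free b); rewrite tb; lia.
  have [dx|ndx] := eqVneq d (x : nat).
    apply: Or32; rewrite dx; apply/eqP; congr pair.
    case: (ltngtP c a) => // ca.
    + case: Ha => [|ta]; first lia.
      by move: (free a.-1); rewrite ta; lia.
    + case: Hc => [|]; first lia.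
      rewrite takenU1 => /orP[/eqP|tc]; first lia.
      by move: (Hab c.-1); rewrite tc; lia.
  apply: Or31; apply/andP; split; last first.
    by apply/eqP => -[ca db]; move: nx; rewrite ca db xab.
  apply/gapP; split => //.
  + case: Hc => [|]; first by left.
    rewrite takenU1 => /orP[/eqP ?|]; last by right.
    by left; lia.
  + case: Hd => [|]; first by left.
    rewrite takenU1 => /orP[/eqP dE|]; last by right.
    by rewrite dE eqxx in ndx.
case=> [/andP[gcd' ne]|/eqP[-> ->]|/eqP[-> ->]].
- have [cdn Hc Hd Hcd] := gapP gcd'.
  have nx : ~~ (c <= x < d).
    apply/negP => xcd; have [ca db] := gap_unique _ _ _ _ _ _ gab gcd' xab xcd.
    by rewrite ca db eqxx in ne.
  apply/gapP; split => //.
  + by case: Hc; [left|right]; rewrite ?takenU1 ?b ?orbT //; apply/orP; right.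
  + by case: Hd; [left|right]; rewrite ?takenU1 ?b ?orbT //; apply/orP; right.
  + move=> k kcd; rewrite takenU1 negb_or Hcd // andbT.
    by apply/eqP => kx; rewrite -kx kcd in nx.
- apply/gapP; split; first lia.
  + by case: Ha; [left|right] => //; rewrite takenU1; apply/orP; right.
  + by right; rewrite takenU1 eqxx.
  + move=> k kax; rewrite takenU1 negb_or Hab ?andbT; last lia.
    by apply/eqP; lia.
- apply/gapP; split; first lia.
  + by right; rewrite takenU1 eqxx.
  + by case: Hb; [left|right] => //; rewrite takenU1; apply/orP; right.
  + move=> k kax; rewrite takenU1 negb_or Hab ?andbT; last lia.
    by apply/eqP; lia.
Qed.

(** * Sums over gaps *)

Definition gapsum {n : nat} (occ : {set 'I_n}) (f : nat -> nat -> nat) : nat :=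
  \sum_(g : 'I_n.+1 * 'I_n.+1 | gap occ g.1 g.2) f g.1 g.2.

Lemma eq_gapsum {n : nat} (occ : {set 'I_n}) (f g : nat -> nat -> nat) :
  (forall a b, gap occ a b -> f a b = g a b) -> gapsum occ f = gapsum occ g.
Proof. by move=> fg; apply: eq_bigr => -[a b] /= /fg. Qed.

Lemma gap_ord {n : nat} {occ : {set 'I_n}} {a b : nat} :
  gap occ a b -> exists a' b' : 'I_n.+1, a = a' /\ b = b'.
Proof.
move=> /gapP[abn _ _ _].
have an : a < n.+1 by lia.
have bn : b < n.+1 by lia.
by exists (Ordinal an), (Ordinal bn).
Qed.

(** The two new gaps are distinct and were not gaps before, because [x] was free. The term [f a b]
    stands on the left to avoid truncated subtraction. *)
Lemma gapsumU1 {n : nat} (occ : {set 'I_n}) (a b : nat) (x : 'I_n)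
    (f : nat -> nat -> nat) :
  gap occ a b -> a <= x < b ->
  gapsum (x |: occ) f + f a b = gapsum occ f + f a x + f x.+1 b.
Proof.
move=> gab xab.
have gax : gap (x |: occ) a x.
  by rewrite (gapU1 _ _ _ _ _ _ gab xab) eqxx orbT.
have gxb : gap (x |: occ) x.+1 b.
  by rewrite (gapU1 _ _ _ _ _ _ gab xab) eqxx !orbT.
have [a' [b' [aE bE]]] := gap_ord gab.
have [_ [x' [_ xE]]] := gap_ord gax.
have [y' [_ [yE _]]] := gap_ord gxb.
have freex := gap_free _ _ _ _ gab xab.
have nax : ~~ gap occ a x.
  apply/gapP => -[_ _ + _]; rewrite freex => -[] // xn.
  by have := ltn_ord x; rewrite xn ltnn.
have nxb : ~~ gap occ x.+1 b by apply/gapP => -[_ + _ _]; rewrite /= freex => -[].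
rewrite /gapsum [X in _ = X + _ + _](bigD1 (a', b')) /=; last by rewrite -aE -bE.
rewrite (bigD1 (a', x')) /=; last by rewrite -aE -xE.
rewrite (bigD1 (y', b')) /=; last first.
  rewrite -bE -yE gxb /= -pair_eqE /= negb_and.
  by apply/orP; left; rewrite -(inj_eq val_inj) /= -aE -yE; apply/eqP; lia.
rewrite -aE -bE -xE -yE.
set S := \sum_(_ | _) _; set S' := \sum_(_ | _) _.
have -> : S = S'; last lia.
apply: eq_bigl => -[c d] /=; rewrite (gapU1 _ _ _ _ _ _ gab xab) -!pair_eqE /=.
rewrite -!(inj_eq val_inj) /= -aE -bE -xE -yE.
have : (c == a :> nat) && (d == x :> nat) -> ~~ gap occ c d.
  by move=> /andP[/eqP-> /eqP->].
have : (c == x.+1 :> nat) && (d == b :> nat) -> ~~ gap occ c d.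
  by move=> /andP[/eqP-> /eqP->].
case: (gap occ c d) => [nB nA|_ _] /=; last by rewrite -andbA -negb_or andbN.
have -> : (c == a :> nat) && (d == x :> nat) = false by apply/negP => /nA.
have -> : (c == x.+1 :> nat) && (d == b :> nat) = false by apply/negP => /nB.
by rewrite /= !orbF !andbT.
Qed.

Lemma gapsum_set0 (n : nat) (f : nat -> nat -> nat) :
  gapsum (set0 : {set 'I_n}) f = f 0 n.
Proof.
have nt k : taken (set0 : {set 'I_n}) k = false.
  by apply/negbTE/negP => /takenP[x]; rewrite inE.
rewrite /gapsum (big_pred1 (ord0, ord_max)) // => -[a b] /=.
apply/gapP/eqP => [[_ Ha Hb _]|[-> ->]]; last first.
  by split => [|||k _]; rewrite ?nt /= ?leqnn; auto.
by congr pair; apply: val_inj; [case: Ha|case: Hb]; rewrite ?nt.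
Qed.

Lemma gapsum_set1 {n : nat} (x : 'I_n) (f : nat -> nat -> nat) :
  gapsum [set x] f = f 0 x + f x.+1 n.
Proof.
have gap0 : gap (set0 : {set 'I_n}) 0 n.
  apply/gapP; split; [by rewrite leqnn|by left|by left|move=> k _].
  by apply/negP => /takenP[y]; rewrite inE.
have := gapsumU1 _ _ _ x f gap0; rewrite setU0 gapsum_set0 ltn_ord => /(_ isT).
lia.
Qed.

(** * Intervals and their full lengths *)

Definition itv (n a b : nat) : {set 'I_n} := [set x : 'I_n | a <= x < b].

Lemma card_itv (n a b : nat) : b <= n -> #|itv n a b| = b - a.
Proof.
elim: b => [|b IH] bn.
  by apply: eq_card0 => x; rewrite inE andbF.
have [ab|ba] := leqP a b; last first.
  rewrite (_ : b.+1 - a = 0); last lia.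
  by apply: eq_card0 => x; rewrite inE; apply/negbTE; lia.
have -> : itv n a b.+1 = Ordinal bn |: itv n a b.
  by apply/setP => x; rewrite !inE -(inj_eq val_inj) /=; lia.
rewrite cardsU1 IH ?(ltnW bn) // inE ltnn andbF /=; lia.
Qed.

(** If [J] left the gap, the taken payphone at that end would lie between two elements of [J], hence
    in [J]. *)
Lemma consecutive_free_sub {n : nat} (occ J : {set 'I_n}) (a b : nat) (x : 'I_n) :
  gap occ a b -> a <= x < b -> x \in J -> consecutive J ->
  [disjoint J & occ] -> J \subset itv n a b.
Proof.
move=> /gapP[abn Ha Hb Hab] xab xJ /forall_inP cJ dJ.
have nJ k : taken occ k -> forall y z : 'I_n, y \in J -> z \in J -> ~ y <= k <= z.
  move=> /takenP[w wocc <-] y z yJ zJ yz.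
  have wJ : w \in J by apply: (implyP (forallP (forall_inP (cJ y yJ) z zJ) w)).
  by rewrite (disjointFr dJ wJ) in wocc.
apply/subsetP => y yJ; rewrite inE; apply/andP; split; rewrite leqNgt; apply/negP => yab.
- case: Ha => [|ta]; first lia.
  by apply: (nJ _ ta y x) => //; lia.
- case: Hb => [|tb]; first by have := ltn_ord y; lia.
  by apply: (nJ _ tb x y) => //; lia.
Qed.

(** By [consecutive_free_sub], a consecutive available set that meets a gap is contained in it, so
    maximality singles out the nonempty gaps. This replaces sets of payphones by pairs of ends. *)
Lemma is_intervalP {n : nat} (occ I : {set 'I_n}) :
  reflect (exists a b, [/\ gap occ a b, a < b & I = itv n a b]) (is_interval occ I).
Proof.
have itv_ok a b : gap occ a b -> a < b ->
    [&& itv n a b != set0, consecutive (itv n a b) & [disjoint itv n a b & occ]].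
  move=> gab ab; have /gapP[abn _ _ Hab] := gab; apply/and3P; split.
  - by rewrite -card_gt0 card_itv; lia.
  - apply/forall_inP => x; rewrite inE => xab; apply/forall_inP => y; rewrite inE => yab.
    by apply/forallP => z; rewrite inE; apply/implyP; lia.
  - rewrite -setI_eq0; apply/eqP/setP => x; rewrite !inE.
    by apply/negP => /andP[/Hab]; rewrite taken_ord => /negbTE->.
apply: (iffP maxsetP) => [[/and3P[/set0Pn[x xI] cI dI] maxI]|[a [b [gab ab ->]]]].
  have [|a [b [gab xab]]] := gap_exists occ x (ltn_ord x).
    by rewrite taken_ord (disjointFr dI xI).
  have ab : a < b by lia.
  exists a, b; split => //; apply/esym/maxI; first exact: itv_ok.
  exact: consecutive_free_sub gab xab xI cI dI.
split=> [|J /and3P[_ cJ dJ] sJ]; first exact: itv_ok.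
apply/eqP; rewrite eqEsubset sJ andbT.
have /gapP[abn _ _ _] := gab.
have an : a < n by lia.
have aab : a <= Ordinal an < b by rewrite leqnn.
apply: (consecutive_free_sub _ _ _ _ _ gab aab _ cJ dJ).
by apply: (subsetP sJ); rewrite inE.
Qed.

(** The only possible neighbours are [a.-1] and [b], and each is taken unless the row ends there. *)
Lemma flanks_itv {n : nat} (occ : {set 'I_n}) (a b : nat) :
  gap occ a b -> a < b -> flanks occ (itv n a b) = (0 < a) + (b < n).
Proof.
move=> gab ab; have /gapP[abn Ha Hb Hab] := gab.
have -> : flanks occ (itv n a b)
    = #|[set x in occ | x.+1 == a] :|: [set x in occ | x == b :> nat]|.
  apply: eq_card => x; rewrite !inE -andb_orr; case xo: (x \in occ) => //=.
  have xab : ~~ (a <= x < b).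
    by apply/negP => /Hab; rewrite taken_ord xo.
  apply/exists_inP/idP => [[y]|]; first by rewrite inE /pdist; lia.
  have an : a < n by lia.
  have bn : b.-1 < n by lia.
  case: eqP => [xa|_ /= xb]; [exists (Ordinal an)|exists (Ordinal bn)];
    rewrite ?inE /pdist /=; lia.
rewrite cardsU (_ : _ :&: _ = set0) ?cards0 ?subn0; last first.
  by apply/setP => x; rewrite !inE; lia.
congr (_ + _).
- case: Ha => [->|/takenP[x xo xE]].
    by apply: eq_card0 => x; rewrite !inE andbF.
  have [a0|a0] := posnP a.
    by apply: eq_card0 => y; rewrite !inE a0 andbF.
  apply: (@eq_card1 _ x) => y; rewrite !inE -(inj_eq val_inj) /=.
  rewrite -(prednK a0) eqSS -xE.
  by case: (y =P x :> nat) => [/val_inj->|_]; rewrite ?xo ?andbF.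
- case: Hb => [->|/takenP[x xo xE]].
    by rewrite ltnn; apply: eq_card0 => x; rewrite !inE ltn_eqF ?andbF.
  have bn : b < n by rewrite -xE; apply: ltn_ord.
  rewrite bn; apply: (@eq_card1 _ x) => y; rewrite !inE -(inj_eq val_inj) /= -xE.
  by case: (y =P x :> nat) => [/val_inj->|_]; rewrite ?xo ?andbF.
Qed.

(** The full length of a gap; by truncated subtraction an empty gap at an end of the row gets 0. *)
Definition span (n a b : nat) : nat :=
  if (0 < a) && (b < n) then b - a else 2 * (b - a) - 1.

Lemma full_length_itv {n : nat} (occ : {set 'I_n}) (a b : nat) :
  gap occ a b -> a < b -> full_length occ (itv n a b) = span n a b.
Proof.
move=> gab ab; have /gapP[/andP[_ bn] _ _ _] := gab.
have int : is_interval occ (itv n a b) by apply/is_intervalP; exists a, b.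
rewrite /full_length /closed_interval int flanks_itv // card_itv //.
by rewrite /span; case: (0 < a); case: (b < n).
Qed.

Lemma span_le_max {n : nat} (occ : {set 'I_n}) (a b : nat) :
  gap occ a b -> a < b -> span n a b <= max_full_length occ.
Proof.
move=> gab ab; rewrite -(full_length_itv occ) //.
by apply: leq_bigmax_cond; apply/is_intervalP; exists a, b.
Qed.

Lemma max_full_length_attained {n : nat} (occ : {set 'I_n}) (a b : nat) :
  gap occ a b -> a < b ->
  exists c d, [/\ gap occ c d, c < d & span n c d = max_full_length occ].
Proof.
move=> gab ab.
have [|I] := @eq_bigmax_cond _ (is_interval occ) (full_length occ).
  by apply/card_gt0P; exists (itv n a b); apply/is_intervalP; exists a, b.
rewrite unfold_in => /is_intervalP[c [d [gcd' cd ->]]] E.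
by exists c, d; split => //; rewrite -(full_length_itv occ) // -E.
Qed.

(** * Distances to the closest occupied payphone *)

Lemma leq_bigminn (I : finType) (A : {set I}) (f : I -> nat) (m k : nat) :
  k <= m -> (k <= \big[minn/m]_(i in A) f i) = [forall i in A, k <= f i].
Proof.
move=> km; rewrite -big_andE; apply: big_morph => // x y; exact: leq_min.
Qed.

Lemma bigminn_le_idx (I : finType) (A : {set I}) (f : I -> nat) (m : nat) :
  \big[minn/m]_(i in A) f i <= m.
Proof.
by elim/big_rec: _ => // i k _ km; rewrite geq_min km orbT.
Qed.

(** Every occupied payphone lies beyond one of the two bounds [a.-1] and [b]. Where the row ends
    instead, the default [n] of the minimum takes over. *)
Lemma closest_dist_gap {n : nat} (occ : {set 'I_n}) (a b : nat) (x : 'I_n) :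
  gap occ a b -> a <= x < b ->
  closest_dist occ x = minn (if 0 < a then x.+1 - a else n) (if b < n then b - x else n).
Proof.
move=> gab xab; have /gapP[abn Ha Hb Hab] := gab; have xn := ltn_ord x.
set m := minn _ _; have mn : m <= n by rewrite /m; case: ifP; case: ifP; lia.
have cn := bigminn_le_idx _ occ (pdist x) n.
apply/eqP; rewrite eqn_leq; apply/andP; split; last first.
  rewrite leq_bigminn //; apply/forall_inP => y yo.
  have yab : ~~ (a <= y < b) by apply/negP => /Hab; rewrite taken_ord yo.
  have yn := ltn_ord y.
  by rewrite /m /pdist; case: ifP; case: ifP; lia.
have := leqnn (closest_dist occ x); rewrite {2}/closest_dist leq_bigminn //.
move=> /forall_inP le_c; rewrite leq_min; apply/andP; split.
- case: ifP => // a0; case: Ha => [|/takenP[y /le_c + yE]]; first lia.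
  by move: yE; rewrite /pdist /=; lia.
- case: ifP => // bn; case: Hb => [|/takenP[y /le_c + yE]]; first lia.
  by move: yE; rewrite /pdist /=; lia.
Qed.

(* The payphones of the gap (a, b) farthest from the occupied ones: an end of the
   row if the gap reaches it, a middle of the gap otherwise. *)
Definition splits (n a b x : nat) : bool :=
  if a == 0 then x == 0
  else if b == n then x.+1 == n
  else (x == a + (b - a).-1./2) || (x == a + uphalf (b - a).-1).

Lemma closest_dist_max {n : nat} (occ : {set 'I_n}) (a b : nat) (x : 'I_n) :
  gap occ a b -> a <= x < b -> (0 < a) || (b < n) ->
  [forall y in itv n a b, closest_dist occ y <= closest_dist occ x] = splits n a b x.
Proof.
move=> gab xab whole; have /gapP[abn _ _ _] := gab.
have xn := ltn_ord x.
rewrite (closest_dist_gap _ _ _ _ gab xab); apply/forall_inP/idP => [maxx|sx y].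
  (* Comparing [x] with one optimal payphone suffices: the end of the row that the gap reaches, or
     else the lower middle. *)
  have test y : a <= y < b ->
      minn (if 0 < a then y.+1 - a else n) (if b < n then b - y else n)
      <= minn (if 0 < a then x.+1 - a else n) (if b < n then b - x else n).
    move=> yab; have yn : y < n by lia.
    have := maxx (Ordinal yn); rewrite inE => /(_ yab).
    by rewrite (closest_dist_gap _ a b).
  rewrite /splits; case: eqP => [a0|na].
    by have := test 0; rewrite a0 /=; case: ifP; lia.
  case: eqP => [bn|nb].
    by have := test b.-1; rewrite bn ltnn; case: ifP; lia.
  by have := test (a + (b - a).-1./2); case: ifP; case: ifP; lia.
rewrite inE => yab; rewrite (closest_dist_gap _ a b) //.
move: sx; rewrite /splits; case: eqP => [a0|na].
  by case: ifP; case: ifP; lia.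
by case: eqP => [bn|nb]; case: ifP; case: ifP; lia.
Qed.

(** * Rule (P4) in terms of gaps *)

(* For a proper part of the row: a semi-closed interval of length 1. *)
Definition lone (n a b : nat) : bool := ~~ ((0 < a) && (b < n)) && (b - a == 1).

(** Folds all branches of (P4) into one condition on gaps; the payphone within the gap is then
    always governed by [splits]. *)
Definition selected {n : nat} (occ : {set 'I_n}) (a b : nat) : bool :=
  [&& a < b, span n a b == max_full_length occ
    & (max_full_length occ == 1) && (0 < gapsum occ (lone n)) ==> lone n a b].

Lemma gapsum_gt0P {n : nat} (occ : {set 'I_n}) (f : nat -> nat -> bool) :
  reflect (exists a b, gap occ a b /\ f a b) (0 < gapsum occ f).
Proof.
rewrite lt0n sum_nat_eq0 negb_forall_in.
apply: (iffP exists_inP) => [[[a b] gab]|[a [b [gab fab]]]].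
  by rewrite /= eqb0 negbK => fab; exists a, b.
have [a' [b' [aE bE]]] := gap_ord gab.
by exists (a', b'); rewrite /= -aE -bE ?fab.
Qed.

Lemma gap_not_whole {n : nat} (occ : {set 'I_n}) (a b : nat) :
  occ != set0 -> gap occ a b -> (0 < a) || (b < n).
Proof.
move=> /set0Pn[x xo] /gapP[abn _ _ Hab].
have : ~~ (a <= x < b) by apply/negP => /Hab; rewrite taken_ord xo.
by have := ltn_ord x; lia.
Qed.

Lemma P2_stepP {n : nat} (occ : {set 'I_n}) (x : 'I_n) : occ != set0 ->
  reflect (exists a b, [/\ gap occ a b, a <= x < b,
                          span n a b = max_full_length occ & splits n a b x])
          (P2_step occ x).
Proof.
move=> occ0; apply: (iffP existsP) => [[I /and4P[]]|[a [b [gab xab L sx]]]].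
  move=> /is_intervalP[a [b [gab ab ->]]] /eqP L; rewrite inE => xab maxx.
  exists a, b; split => //; first by rewrite -L full_length_itv.
  by rewrite -(closest_dist_max occ) // (gap_not_whole occ).
have ab : a < b by lia.
exists (itv n a b); apply/and4P; split.
- by apply/is_intervalP; exists a, b.
- by rewrite full_length_itv // L.
- by rewrite inE.
- by rewrite closest_dist_max // (gap_not_whole occ).
Qed.

Lemma semi_closed_lone {n : nat} (occ I : {set 'I_n}) : occ != set0 ->
  reflect (exists a b, [/\ gap occ a b, lone n a b & I = itv n a b])
          (semi_closed occ I && (#|I| == 1)).
Proof.
move=> occ0; apply: (iffP andP) => [[/andP[]]|[a [b [gab lab ->]]]].
  move=> /is_intervalP[a [b [gab ab ->]]]; rewrite flanks_itv // => fl card1.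
  exists a, b; split => //; have /gapP[abn _ _ _] := gab.
  by move: fl card1; rewrite card_itv /lone; lia.
have /gapP[abn _ _ _] := gab.
have ab : a < b by move: lab; rewrite /lone; lia.
have := gap_not_whole _ _ _ occ0 gab; move: lab.
rewrite /semi_closed flanks_itv // card_itv /lone; last lia.
move=> lab nw; split; last lia.
apply/andP; split; last lia.
by apply/is_intervalP; exists a, b.
Qed.

Lemma splits_unit (n a b x : nat) : a <= x < b -> b <= n -> b - a = 1 -> splits n a b x.
Proof.
move=> xab bn ba; rewrite /splits; case: eqP => [|_]; first lia.
by case: eqP => [|_]; lia.
Qed.

(** Unless the greatest full length is 1, this is (P2). If it is 1, every nonempty gap is a single
    payphone, [splits] holds automatically by [splits_unit], and only the preference for lone gaps
    remains. *)
Lemma P4_stepP {n : nat} (occ : {set 'I_n}) (x : 'I_n) : occ != set0 ->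
  reflect (exists a b, [/\ gap occ a b, a <= x < b, selected occ a b
                         & splits n a b x])
          (P4_step occ x).
Proof.
move=> occ0; rewrite /P4_step /selected.
case: (max_full_length occ =P 1) => [L|nL]; last first.
  apply: (iffP (P2_stepP _ _ occ0)) => -[a [b [gab xab sp sx]]]; exists a, b.
    by rewrite sp eqxx /=; split => //; lia.
  by case/and3P: sp => _ /eqP ->.
have exE : [exists I : {set 'I_n}, semi_closed occ I && (#|I| == 1)]
    = (0 < gapsum occ (lone n)).
  apply/existsP/gapsum_gt0P => [[I /semi_closed_lone[] // a [b [gab lab _]]]|].
    by exists a, b.
  move=> [a [b [gab lab]]]; exists (itv n a b).
  by apply/semi_closed_lone => //; exists a, b.
rewrite exE L /=; case: ifP => nolone.
  apply: (iffP existsP) => [[I]|[a [b [gab xab /and3P[ab sp lab] sx]]]].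
    rewrite andbA => /andP[/(semi_closed_lone _ _ occ0)[a [b [gab lab ->]]]].
    rewrite inE => xab; exists a, b.
    have /gapP[/andP[_ bn] _ _ _] := gab.
    move: (lab) => /andP[/negbTE semi /eqP ba].
    split=> //; last exact: splits_unit.
    by rewrite lab /span semi ba; apply/and3P; split; lia.
  exists (itv n a b); rewrite andbA inE xab andbT.
  by apply/semi_closed_lone => //; exists a, b.
apply: (iffP idP) => [xfree|[a [b [gab xab _ _]]]]; last first.
  by rewrite -taken_ord (gap_free _ _ _ _ gab).
have [|a [b [gab xab]]] := gap_exists occ x (ltn_ord x); first by rewrite taken_ord.
have ab : a < b by lia.
have /gapP[/andP[_ bn] _ _ _] := gab.
have nlab : ~~ lone n a b.
  by apply/negP => lab; move/gapsum_gt0P: nolone; case; exists a, b.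
have := span_le_max _ _ _ gab ab; rewrite L => sp.
have ba : b - a = 1.
  by move: sp nlab; rewrite /span /lone; case: ifP; lia.
exists a, b; split => //; last exact: splits_unit.
by apply/and3P; split => //; move: sp; rewrite /span ba; case: ifP.
Qed.

(** A closed gap has one middle if its length is odd and two if it is even. A gap at an end of the
    row offers that end only, and its full length is odd. *)
Lemma card_splits (n a b : nat) : a < b <= n -> (0 < a) || (b < n) ->
  #|[set x in itv n a b | splits n a b x]| = (~~ odd (span n a b)).+1.
Proof.
move=> abn nw.
have single k : k < n -> (forall x, x < n -> (a <= x < b) && splits n a b x = (x == k)) ->
    #|[set x in itv n a b | splits n a b x]| = 1.
  move=> kn sk; apply: (@eq_card1 _ (Ordinal kn)) => x.
  by rewrite !inE sk // -(inj_eq val_inj).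
rewrite /span; case: ifP => [ab0|nc] /=.
- case bo: (odd (b - a)) => /=.
    apply: (single (a + (b - a).-1./2)) => [|x xn]; first lia.
    by rewrite /splits; do 2![case: eqP => ?]; lia.
  have kn : a + (b - a).-1./2 < n by lia.
  have kn' : a + uphalf (b - a).-1 < n by lia.
  rewrite (_ : [set x in _ | _] = [set Ordinal kn; Ordinal kn']).
    by rewrite cards2 -(inj_eq val_inj) /=; case: eqP => //; lia.
  apply/setP => x; rewrite !inE -!(inj_eq val_inj) /= /splits.
  by do 2![case: eqP => ?]; lia.
- have -> : odd (2 * (b - a) - 1) by lia.
  have [a0|a0] := posnP a.
    by apply: (single 0) => [|x xn]; rewrite /splits ?a0 /=; lia.
  apply: (single n.-1) => [|x xn]; first lia.
  by rewrite /splits; do 2![case: eqP => ?]; lia.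
Qed.

(** Double counting of pairs of a payphone and its gap: an allowed payphone lies in exactly one gap,
    and [card_splits] counts the payphones within a gap. *)
Lemma card_P4_step {n : nat} (occ : {set 'I_n}) : occ != set0 ->
  #|[set x | P4_step occ x]|
  = gapsum occ (fun a b => selected occ a b * (~~ odd (span n a b)).+1).
Proof.
move=> occ0.
rewrite -sum1_card (eq_bigr (fun x : 'I_n => gapsum occ (fun a b =>
  [&& selected occ a b, a <= x < b & splits n a b x]))); last first.
  move=> x; rewrite inE => /P4_stepP[] // a [b [gab xab sel sx]].
  have [a' [b' [aE bE]]] := gap_ord gab.
  rewrite /gapsum (bigD1 (a', b')) /= -aE -bE // sel xab sx /= big1 // => -[c d].
  rewrite /= => /andP[gcd' ne]; case xcd: (c <= x < d); last by rewrite andbF.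
  have [ca db] := gap_unique _ _ _ _ _ _ gab gcd' xab xcd.
  case/eqP: ne; congr pair; apply: val_inj; rewrite /= -?aE -?bE //.
rewrite exchange_big /=; apply: eq_bigr => -[a b] /= gab.
case sel: (selected occ a b); last by rewrite big1.
have /gapP[/andP[_ bn] _ _ _] := gab.
have ab : a < b by case/and3P: sel.
rewrite mul1n -card_splits ?ab ?(gap_not_whole occ) //= -sum1_card.
rewrite big_mkcond [RHS]big_mkcond /=; apply: eq_bigr => x _; rewrite !inE.
case: ifP => [_|/negbT np4]; first by case: ifP.
case: ifP => // /andP[xab sx]; case/negP: np4.
by apply/P4_stepP => //; exists a, b.
Qed.

(** * The multiset of full lengths still to be selected *)

(** The share of one gap in the multiset M. Lone gaps get nothing, since [lone] counts them
    separately. *)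
Definition content (n a b : nat) : {mset nat} :=
  if (0 < a) && (b < n) then Smset (b - a)
  else if b - a == 1 then mset0 else Smset' (b - a).

Lemma Smset_gt (m k : nat) : m < k -> Smset m k = 0.
Proof.
elim/ltn_ind: m => -[|m] IH mk; first by rewrite Smset0 mset0E.
rewrite SmsetS !msetE2 !IH ?addn0; try lia.
by rewrite msetnE; case: eqP => //; lia.
Qed.

Lemma Smset'_gt (m k : nat) : 2 * m - 1 < k -> Smset' m k = 0.
Proof.
case: m => [|m] mk; first by rewrite mset0E.
rewrite /Smset' !msetE2 Smset_gt ?msetnE; last lia.
by case: eqP => //; lia.
Qed.

Lemma content_gt (n a b k : nat) : span n a b < k -> content n a b k = 0.
Proof.
rewrite /span /content; case: ifP => _ kab; first exact: Smset_gt.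
by case: ifP => _; [rewrite mset0E|apply: Smset'_gt].
Qed.

(** For a closed gap this is the recursion of S, the two halves appearing in either order. A
    semi-closed gap of length l loses its end payphone, which leaves an empty gap and a closed gap
    of length l - 1, in accordance with the definition of S'(l). *)
Lemma content_split (n a b x k : nat) :
  a <= x < b -> b <= n -> (0 < a) || (b < n) -> ~~ lone n a b -> splits n a b x ->
  content n a b k = (k == span n a b) + content n a x k + content n x.+1 b k.
Proof.
move=> xab bn nw nl sx; rewrite /content /span.
have xn : x < n by lia.
rewrite xn /= andbT.
case: ifP => [/andP[a0 bln]|nc].
  rewrite a0 bln; have -> : b - a = (b - a).-1.+1 by lia.
  rewrite SmsetS !msetE2 msetnE.
  move: sx; rewrite /splits; case: eqP => [|_]; first lia.
  case: eqP => [|_]; first lia.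
  case/orP => /eqP sx.
    have -> : x - a = (b - a).-1./2 by lia.
    by have -> : b - x.+1 = uphalf (b - a).-1 by lia.
  have -> : x - a = uphalf (b - a).-1 by lia.
  have -> : b - x.+1 = (b - a).-1./2 by lia.
  by rewrite -!addnA; congr (_ + _); rewrite addnC.
move: nl; rewrite /lone nc /= => /negbTE nl; rewrite nl.
have -> : Smset' (b - a) k = (k == 2 * (b - a) - 1) + Smset (b - a).-1 k.
  have -> : b - a = (b - a).-1.+1 by lia.
  by rewrite /Smset' !msetE2 msetnE addnC.
move: sx; rewrite /splits; case: eqP => [a0|a0].
  move=> /eqP x0; rewrite a0 x0 /= !subn0 mset0E addn0 -!subn1.
  by have -> : b < n by lia.
have -> : 0 < a by lia.
case: eqP => [bE|]; last lia.
move=> /eqP xE; rewrite bE xE ltnn subnn /= mset0E addn0.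
by have -> : x - a = (n - a).-1 by lia.
Qed.

(** Each part is either closed or empty, so no lone gap arises after the first person. *)
Lemma lone_split (n a b x : nat) :
  a <= x < b -> b <= n -> (0 < a) || (b < n) -> splits n a b x ->
  (lone n a x = false) * (lone n x.+1 b = false).
Proof.
rewrite /lone /splits => xab bn nw.
by do 2![case: eqP => ?] => ?; split; lia.
Qed.

Lemma Smset_diag (m : nat) : 0 < m -> Smset m m = 1.
Proof.
case: m => // m _; rewrite SmsetS !msetE2 msetnxx !Smset_gt //; lia.
Qed.

(** The full length is the largest element of the content and occurs once. Hence, lone gaps aside,
    the multiplicity of the maximum in M counts the gaps attaining it. *)
Lemma content_max (n a b L : nat) :
  (0 < a) || (b < n) -> span n a b <= L -> 0 < L -> ~~ lone n a b ->
  content n a b L = (a < b) && (span n a b == L).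
Proof.
move=> nw sL L0 nl.
have [ab|ba] := ltnP a b; last first.
  by apply: content_gt; apply: leq_ltn_trans L0; rewrite /span; case: ifP; lia.
case: eqP => [sE|sE]; last by apply: content_gt; lia.
rewrite -sE /content /span; move: nl; rewrite /lone.
case: ifP => /= [_ _|_ /negbTE->]; first by rewrite Smset_diag //; lia.
have -> : b - a = (b - a).-1.+1 by lia.
by rewrite /Smset' !msetE2 msetnxx Smset_gt //; lia.
Qed.

Lemma gapsum_lone_pop {n : nat} (occ : {set 'I_n}) (a b : nat) (x : 'I_n) :
  occ != set0 -> gap occ a b -> a <= x < b -> splits n a b x ->
  gapsum (x |: occ) (lone n) + lone n a b = gapsum occ (lone n).
Proof.
move=> occ0 gab xab sx; have /gapP[/andP[_ bn] _ _ _] := gab.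
rewrite (gapsumU1 _ _ _ _ _ gab xab).
have [-> ->] := lone_split _ _ _ _ xab bn (gap_not_whole _ _ _ occ0 gab) sx.
by rewrite !addn0.
Qed.

Lemma gapsum_content_pop {n : nat} (occ : {set 'I_n}) (a b k : nat) (x : 'I_n) :
  occ != set0 -> gap occ a b -> a <= x < b -> splits n a b x -> ~~ lone n a b ->
  gapsum occ (fun a b => content n a b k)
  = (k == span n a b) + gapsum (x |: occ) (fun a b => content n a b k).
Proof.
move=> occ0 gab xab sx nl; have /gapP[/andP[_ bn] _ _ _] := gab.
have nw := gap_not_whole _ _ _ occ0 gab.
have := gapsumU1 _ _ _ _ (fun a b => content n a b k) gab xab.
by rewrite (content_split _ _ _ _ _ xab bn nw nl sx); lia.
Qed.

Lemma content_empty (n a b k : nat) : b <= a -> content n a b k = 0.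
Proof.
by move=> ba; rewrite /content (_ : b - a = 0) ?if_same ?mset0E //=; lia.
Qed.

Lemma gapsum_content_pop_lone {n : nat} (occ : {set 'I_n}) (a b k : nat) (x : 'I_n) :
  gap occ a b -> a <= x < b -> lone n a b ->
  gapsum occ (fun a b => content n a b k)
  = gapsum (x |: occ) (fun a b => content n a b k).
Proof.
move=> gab xab lab; have := gapsumU1 _ _ _ _ (fun a b => content n a b k) gab xab.
have /andP[/negbTE nc ba] := lab.
rewrite (content_empty n a x); last lia.
rewrite (content_empty n x.+1 b); last lia.
by rewrite /content nc ba mset0E; lia.
Qed.

(** * Counting the completions of a partial assignment *)

(** All allowed moves lead to the same number [const] of completions, so each induction step
    multiplies it by the number of moves. The cut [2 * n] exceeds every full length. *)
Lemma completions_weight {n : nat} (k : nat) (occ : {set 'I_n}) :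
  occ != set0 -> #|occ| + k = n ->
  completions 'I_n (fun occ x => (occ != set0) ==> P4_step occ x) k occ
  = (gapsum occ (lone n))`!
    * weight (2 * n) (fun k => gapsum occ (fun a b => content n a b k)).
Proof.
elim: k occ => [|k IH] occ occ0 card_occ.
  have occT : occ = setT.
    apply/eqP; rewrite eqEcard subsetT cardsT card_ord /=.
    by rewrite addn0 in card_occ; rewrite [leqRHS]card_occ.
  have empty a b : gap occ a b -> b <= a.
    move=> /gapP[abn _ _ Hab]; rewrite leqNgt; apply/negP => ab.
    have an : a < n by lia.
    by move: (Hab a); rewrite (taken_ord _ (Ordinal an)) occT inE leqnn ab => /(_ isT).
  have -> : gapsum occ (lone n) = 0.
    by apply: big1 => -[a b] /= /empty ba; rewrite /lone; lia.
  rewrite (eq_weight _ _ (fun=> 0)) => [|j].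
    by rewrite /weight big1 // big1.
  by apply: big1 => -[a b] /= /empty /content_empty.
have exx : exists x : 'I_n, x \notin occ.
  apply/existsP; rewrite -negb_forall; apply/negP => /forallP H.
  have : #|occ| = n by rewrite -[RHS]card_ord; apply: eq_card => x; rewrite H.
  lia.
have [x0 x0free] := exx.
have [|a0 [b0 [gab0 xab0]]] := gap_exists occ x0 (ltn_ord x0); first by rewrite taken_ord.
have ab0 : a0 < b0 by lia.
have [c [d [gcd' cd Lcd]]] := max_full_length_attained _ _ _ gab0 ab0.
have /gapP[/andP[_ dn] _ _ _] := gcd'.
set L := max_full_length occ in Lcd *.
have nwcd := gap_not_whole _ _ _ occ0 gcd'.
have L0 : 0 < L by rewrite -Lcd /span; case: ifP; lia.
have L2n : L < 2 * n by rewrite -Lcd /span; case: ifP; lia.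
set f := fun k => gapsum occ _.
(* When lone gaps are being served, a move uses up one of them and leaves M unchanged; otherwise it
   removes one [L] from M. *)
pose const := if (L == 1) && (0 < gapsum occ (lone n))
  then (gapsum occ (lone n)).-1`! * weight (2 * n) f
  else (gapsum occ (lone n))`! * weight (2 * n) (fun k => f k - (k == L)).
have lone_span a b : lone n a b -> span n a b = 1.
  by rewrite /lone /span; case: ifP => //=; lia.
have step x : P4_step occ x -> (x \notin occ) /\
    completions 'I_n (fun occ x => (occ != set0) ==> P4_step occ x) k (x |: occ) = const.
  move=> /P4_stepP[] // a [b [gab xab /and3P[ab /eqP sp sel] sx]].
  rewrite -/L in sp sel.
  have xo : x \notin occ by rewrite -taken_ord (gap_free _ _ _ _ gab).
  split=> //; rewrite IH; first last.
  - by rewrite cardsU1 xo; lia.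
  - by apply/set0Pn; exists x; rewrite setU11.
  have := gapsum_lone_pop _ _ _ _ occ0 gab xab sx.
  rewrite /const; case lab: (lone n a b) => /= pop.
    have L1 : L = 1 by rewrite -sp lone_span.
    rewrite L1 -pop addn1 /=; congr (_ * _); apply: eq_weight => j.
    by rewrite /f (gapsum_content_pop_lone _ _ _ _ _ gab xab lab).
  rewrite addn0 in pop.
  rewrite lab implybF in sel; rewrite (negbTE sel) pop; congr (_ * _).
  apply: eq_weight => j.
  by rewrite /f (gapsum_content_pop _ _ _ _ _ occ0 gab xab sx) ?lab // sp addKn.
rewrite /= occ0 /=.
rewrite (eq_bigl (fun x => x \in [set x | P4_step occ x])) => [|x]; last first.
  by rewrite inE /=; case: (boolP (P4_step occ x)) => [/step[->]|]; rewrite ?andbF.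
rewrite (eq_bigr (fun=> const)) => [|x]; last by rewrite inE => /step[].
rewrite sum_nat_const card_P4_step // /const.
case: ifP => [/andP[/eqP L1 lone0]|sel].
  (* The selected gaps are now the lone ones, with one payphone each, so their number extends the
     factorial. *)
  rewrite (eq_gapsum _ _ (lone n)) => [|a b gab].
    by case: (gapsum occ _) lone0 => // s _; rewrite mulnA factS.
  have /gapP[/andP[_ bn] _ _ _] := gab.
  rewrite /selected -/L L1 lone0 /=.
  case lab: (lone n a b); last by rewrite !andbF.
  rewrite (lone_span _ _ lab) /= andbT.
  by move: lab; rewrite /lone; lia.
rewrite (eq_gapsum _ _ (fun a b => content n a b L * (~~ odd L).+1)) => [|a b gab].
  rewrite -/L.
  have -> : gapsum occ (fun a b => content n a b L * (~~ odd L).+1)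
      = f L * (~~ odd L).+1 by rewrite /f /gapsum big_distrl.
  rewrite mulnCA; congr (_ * _); symmetry; apply: weight_pop; first lia.
  (* The subtraction in [const] is exact: the gap [(c, d)] attains [L] and is not lone, so it
     contributes a copy of [L]. *)
  move=> j; case: eqP => [->|_]; rewrite ?subn0 // subnKC // /f /gapsum.
  have [c' [d' [cE dE]]] := gap_ord gcd'.
  rewrite (bigD1 (c', d')) /= -cE -dE // content_max ?cd ?Lcd ?eqxx //.
  apply/negP => lcd; move: sel; rewrite -Lcd lone_span //=.
  by move/gapsum_gt0P; case; exists c, d.
have /gapP[/andP[_ bn] _ _ _] := gab.
have nw := gap_not_whole _ _ _ occ0 gab.
rewrite /selected -/L sel /= andbT.
have [ab|ba] := ltnP a b; last by rewrite content_empty.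
have := span_le_max _ _ _ gab ab; rewrite -/L => sL.
case lab: (lone n a b); last by rewrite content_max ?ab ?lab //=; case: eqP => // ->.
have sp := lone_span _ _ lab.
(* A lone gap is not selected in this phase: [L] must exceed 1, since otherwise lone gaps would be
   served. *)
have nL : 1 < L.
  rewrite ltn_neqAle L0 andbT eq_sym; apply/negP => L1; move: sel; rewrite L1 /=.
  by move/gapsum_gt0P; case; exists a, b.
by rewrite content_gt sp //; case: eqP => //; lia.
Qed.

(** * The formula for P_4(n) *)

(** The first person, at position [i] counted from 0, leaves the gaps [(0, i)] and [(i.+1, n)], to
    which [completions_weight] applies. *)
Lemma P4_sum (n : nat) : 0 < n ->
  P4 n = \sum_(0 <= i < n) (lone n 0 i + lone n i.+1 n)`!
           * F (content n 0 i `+` content n i.+1 n).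
Proof.
case: n => // n _; rewrite big_mkord P4_completions /=.
apply: eq_big => x; first by rewrite inE eqxx.
move=> _; rewrite setU0 completions_weight ?cards1 ?add1n //; last first.
  by apply/set0Pn; exists x; rewrite set11.
rewrite gapsum_set1; congr (_ * _).
rewrite (F_weight (2 * n.+1)).
  by apply: eq_weight => k; rewrite gapsum_set1 msetE2.
move=> k kB; have xn := ltn_ord x.
rewrite msetE2 !content_gt // /span ltnn ?andbF /=; lia.
Qed.

Lemma F_mset0 : F mset0 = 1.
Proof.
rewrite (F_weight 0) => [|k _]; last by rewrite mset0E.
by rewrite /weight !big_geq.
Qed.

Lemma end_content_lone (n a b : nat) : lone n a b -> content n a b = mset0.
Proof. by rewrite /lone /content => /andP[/negbTE-> ->]. Qed.

Lemma end_content (n a b : nat) :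
  ~~ ((0 < a) && (b < n)) -> b - a != 1 -> content n a b = Smset' (b - a).
Proof. by rewrite /content => /negbTE-> /negbTE->. Qed.

Theorem theorem7 :
  P4 1 = 1 /\ P4 2 = 2 /\ P4 3 = 4 /\
  forall n : nat, 4 <= n ->
    P4 n = 2 * F (Smset' (n - 1)) + 2 * F (Smset' (n - 2))
           + \sum_(3 <= i < n - 1) F (Smset' (i - 1) `+` Smset' (n - i)).
Proof.
(* S'(2) is {1, 3}; it occurs for three payphones when the first person takes an end. *)
have F13 : F (Smset' 2) = 1.
  rewrite (F_weight 4) => [|k k4]; last by rewrite Smset'_gt //; lia.
  rewrite /weight big_mkcond unlock /=.
  by rewrite /Smset' /Smset /= !msetE2 !msetnE /= !mset0E.
split; first by rewrite P4_sum // big_nat1 /content /= msetD0 F_mset0.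
split; first by rewrite P4_sum // big_nat_recl // big_nat1 /content /= !msetD0 !F_mset0.
split.
  rewrite P4_sum // !big_nat_recl // big_geq // /content /= !(msetD0, mset0D).
  by rewrite F_mset0 F13.
move=> n n4; rewrite P4_sum; last lia.
have -> : n = (n - 4).+2.+2 by lia.
move: (n - 4) => {n4}n.
have lone0 i : lone n.+4 0 i = (i == 1) by rewrite /lone subn0.
have lone1 i : lone n.+4 i n.+4 = (n.+4 - i == 1) by rewrite /lone ltnn andbF.
have content0 i : i != 1 -> content n.+4 0 i = Smset' i.
  by move=> i1; rewrite end_content ?subn0.
have content1 i : n.+4 - i != 1 -> content n.+4 i n.+4 = Smset' (n.+4 - i).
  by move=> i1; rewrite end_content // ltnn andbF.
(* The row now has [n.+4] payphones. The two outermost positions on each side are split off: an end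
   leaves one semi-closed interval, and the position next to an end leaves a lone gap and one longer
   interval. *)
rewrite big_ltn // big_ltn // big_nat_recr // big_nat_recr //.
(* The statement counts positions from 1, [P4_sum] from 0. *)
rewrite [in RHS]big_add1 !subSS !subn0 -[n.+3.-1]/n.+2.
rewrite [X in _ + (_ + (X + _ + _))](_ : _ =
    \sum_(2 <= i < n.+2) F (Smset' (i.+1 - 1) `+` Smset' (n.+4 - i.+1))); last first.
  apply: eq_big_nat => i /andP[i2 iN].
  rewrite content0 ?content1 ?lone0 ?lone1 ?subn1; try lia.
  have -> : (i == 1) = false by lia.
  have -> : (n.+4 - i.+1 == 1) = false by lia.
  by rewrite mul1n.
rewrite !lone0 !lone1 (end_content_lone n.+4 0 1) // (end_content_lone n.+4 n.+3 n.+4);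
  last by rewrite lone1 subSnn.
rewrite !content0 // !content1 ?subnn ?subSnn // !msetD0 !mset0D !subSS !subn0.
rewrite /= !mul1n; lia.
Qed.
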